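(* Let $\overline{A}=(A_1,\dots,A_X)$ be a cardinality with associated space $\mathcal{A}$, and let $\mathsf{C},\mathsf{Z},\mathsf{S}\subseteq\mathcal{A}$ be the correlation, uniform and signaling subspaces. Then $\mathcal{A}$ decomposes as the series of subspaces $$0\subseteq\mathsf{C}\subseteq\mathsf{C}\oplus\mathsf{Z}\subseteq\mathsf{C}\oplus\mathsf{Z}\oplus\mathsf{S}=\mathcal{A},$$ each of which is invariant under all local transformations $\Lambda:\mathcal{A}\to\mathcal{A}$, and this decomposition is unique: after deleting repeated terms, this chain is the one and only chain $0=\mathsf{V}_0\subsetneq\mathsf{V}_1\subsetneq\dots\subsetneq\mathsf{V}_m=\mathcal{A}$ of subspaces invariant under all local transformations $\mathcal{A}\to\mathcal{A}$ whose successive quotients $\mathsf{V}_i/\mathsf{V}_{i-1}$ are irreducible (i.e. have no invariant subspace other than $0$ and themselves, for the induced action of local transformations).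
   Context: A cardinality $\overline{A}=(A_1,\dots,A_X)$ is a finite nonempty sequence of positive integers: a device has inputs $x\in\{1,\dots,X\}$ and, for input $x$, outputs $a\in\{1,\dots,A_x\}$. The associated space is $\mathcal{A}=\mathbb{R}^{\sum_x A_x}$ with standard basis vectors $[a|x]$ indexed by pairs $(a,x)$. A deterministic local map $\mathcal{A}\to\mathcal{A}$ is determined by $\xi:\{1,\dots,X\}\to\{1,\dots,X\}$ and $\alpha_{x'}:\{1,\dots,A_{\xi(x')}\}\to\{1,\dots,A_{x'}\}$; its matrix has entry $\Lambda_{(a',x'),(a,x)}=1$ if $x=\xi(x')$ and $a'=\alpha_{x'}(a)$, and $0$ otherwise. A local transformation is a convex mixture of deterministic local maps. A subspace $\mathsf{V}\subseteq\mathcal{A}$ is invariant if $\Lambda\vec v\in\mathsf{V}$ for every $\vec v\in\mathsf{V}$ and every local transformation $\Lambda:\mathcal{A}\to\mathcal{A}$. Define $\vec Z=\sum_{x=1}^X\sum_{a=1}^{A_x}\frac{1}{A_x}[a|x]$; $\vec C^{\,i|x}=\frac{1}{A_x}\left([i|x]-[A_x|x]\right)$ for $x\in\{1,\dots,X\}$, $i\in\{1,\dots,A_x-1\}$; $\vec S^{\,k}=\sum_{a=1}^{A_k}\frac{X}{A_k}[a|k]-\sum_{x=1}^X\sum_{a=1}^{A_x}\frac{1}{A_x}[a|x]$ for $k\in\{1,\dots,X-1\}$; and $\mathsf{Z}=\mathrm{span}(\vec Z)$, $\mathsf{C}=\mathrm{span}\{\vec C^{\,i|x}\}_{i,x}$,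 $\mathsf{S}=\mathrm{span}\{\vec S^{\,k}\}_k$ ($\mathsf{C}$ or $\mathsf{S}$ may be zero in degenerate cases). *)

(* Defs.v *)
From HB Require Import structures.
From mathcomp Require Import all_boot all_order all_algebra.
From mathcomp Require Import reals.
Set Implicit Arguments.
Unset Strict Implicit.
Unset Printing Implicit Defensive.
Import Order.TTheory GRing.Theory Num.Theory.
Local Open Scope ring_scope.

(* Inputs and outputs are numbered from 0: the input called k (resp. the
   output called i) in 1-based notation is the ordinal of value k - 1 (resp.
   i - 1). *)
Record cardinality := Cardinality {
  ninputs : nat;
  noutputs : 'I_ninputs -> nat;
  ninputs_gt0 : (0 < ninputs)%N;
  noutputs_gt0 : forall x, (0 < noutputs x)%N }.

Definition label (A : cardinality) := {x : 'I_(ninputs A) & 'I_(noutputs x)}.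

(* [lab x a] is the index (a, x) of the basis vector [a|x]. *)
Definition lab (A : cardinality) (x : 'I_(ninputs A)) (a : 'I_(noutputs x)) :
  label A := Tagged (fun x => 'I_(noutputs x)) a.

Definition device_space (R : realType) (A : cardinality) := {ffun label A -> R^o}.

Definition ket (R : realType) (A : cardinality) (p : label A) : device_space R A :=
  [ffun q => (q == p)%:R].

Definition last_output (A : cardinality) (x : 'I_(ninputs A)) :
    'I_(noutputs x) :=
  Ordinal (etrans (ltn_predL _) (noutputs_gt0 x)).

Section LocalMaps.
Variables (R : realType) (A : cardinality).

Definition mx_act (M : label A -> label A -> R) (v : device_space R A) : device_space R A :=
  [ffun q => \sum_p M q p * v p].

Fact mx_act_linear M : linear (mx_act M).
Proof.
move=> c u v; apply/ffunP => q; rewrite !ffunE scaler_sumr -big_split /=.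
by apply: eq_bigr => p _; rewrite !ffunE mulrDr mulrCA.
Qed.

HB.instance Definition _ M :=
  GRing.isLinear.Build R (device_space R A) (device_space R A) *:%R (mx_act M)
    (mx_act_linear M).

(* The equation a' = alpha x' a only typechecks once x = xi x' is known, hence
   the quantification over the outputs b of the input xi x'. *)
Definition det_entry (xi : 'I_(ninputs A) -> 'I_(ninputs A))
    (alpha : forall x', 'I_(noutputs (xi x')) -> 'I_(noutputs x'))
    (q p : label A) : R :=
  [exists b : 'I_(noutputs (xi (tag q))),
    (p == lab b) && (tagged q == alpha (tag q) b)]%:R.

Definition deterministic_local (L : 'End(device_space R A)) : Prop :=
  exists (xi : 'I_(ninputs A) -> 'I_(ninputs A))
         (alpha : forall x', 'I_(noutputs (xi x')) -> 'I_(noutputs x')),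
    L = linfun (mx_act (det_entry alpha)).

Definition local_transformation (L : 'End(device_space R A)) : Prop :=
  exists (n : nat) (w : 'I_n -> R) (D : 'I_n -> 'End(device_space R A)),
    [/\ forall i, 0 <= w i, \sum_i w i = 1,
        forall i, deterministic_local (D i) & L = \sum_i w i *: D i].

Definition invariant_subspace (V : {vspace device_space R A}) : Prop :=
  forall L, local_transformation L -> forall v, v \in V -> L v \in V.

End LocalMaps.

Section Subspaces.
Variables (R : realType) (A : cardinality).
Implicit Types x k : 'I_(ninputs A).

Definition Zvec : device_space R A :=
  \sum_x \sum_(a < noutputs x) (noutputs x)%:R^-1 *: ket R (lab a).

Definition Cvec x (i : 'I_(noutputs x)) : device_space R A :=
  (noutputs x)%:R^-1 *: (ket R (lab i) - ket R (lab (last_output x))).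

Definition Svec k : device_space R A :=
  \sum_(a < noutputs k)
      ((ninputs A)%:R / (noutputs k)%:R) *: ket R (lab a)
  - Zvec.

Definition Zsp : {vspace device_space R A} := <[Zvec]>%VS.

Definition Csp : {vspace device_space R A} :=
  <<[seq Cvec (widen_ord (leq_pred (noutputs x)) i)
      | x <- enum 'I_(ninputs A), i <- enum 'I_(noutputs x).-1]>>%VS.

Definition Ssp : {vspace device_space R A} :=
  <<[seq Svec (widen_ord (leq_pred (ninputs A)) i)
      | i <- enum 'I_(ninputs A).-1]>>%VS.

End Subspaces.

(* The quotient of a vector space by a subspace W, carried by a complement of
   W; the canonical projection is the projection along W.  It is linear and
   onto with kernel W (quot_proj_ker, quot_proj_onto). *)
Section Quotient.
Variables (K : fieldType) (vT : vectType K) (W : {vspace vT}).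

Definition quot_space : vectType K := subvs_of (W^C)%VS.

Definition quot_proj : 'Hom(vT, quot_space) :=
  linfun (vsproj (W^C)%VS \o daddv_pi (W^C)%VS W).

Definition quot_repr : quot_space -> vT := vsval.

(* [quot_map f] is the map v + W |-> f v + W, when f maps W into itself
   (quot_map_proj). *)
Definition quot_map (f : 'End(vT)) (q : quot_space) : quot_space :=
  quot_proj (f (quot_repr q)).

Let capCW : (W^C :&: W = 0)%VS. Proof. by rewrite capvC capv_compl. Qed.

Let repr_proj v : quot_repr (quot_proj v) = daddv_pi (W^C)%VS W v.
Proof. by rewrite lfunE /= /quot_repr vsprojK ?memv_pi. Qed.

Lemma quot_projK q : quot_proj (quot_repr q) = q.
Proof.
by apply: val_inj; rewrite [LHS]repr_proj daddv_pi_id ?capCW //; exact: subvsP.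
Qed.

Let proj_rest v : v - quot_repr (quot_proj v) \in W.
Proof.
have vCW : v \in (W^C + W)%VS by rewrite addvC addv_complf memvf.
rewrite repr_proj -{1}(daddv_pi_add capCW vCW) addrAC subrr add0r.
exact: memv_pi.
Qed.

Lemma quot_proj_ker : lker quot_proj = W.
Proof.
apply/vspaceP => v; rewrite memv_ker; apply/eqP/idP => [v0 | Wv].
  by have := proj_rest v; rewrite v0 subr0.
apply: val_inj; apply/eqP; rewrite -memv0 -capCW memv_cap subvsP /=.
by rewrite -[X in X \in _](subKr v) rpredB ?proj_rest.
Qed.

Lemma quot_proj_onto : limg quot_proj = fullv.
Proof.
apply/vspaceP => q; rewrite memvf -[q]quot_projK.
by rewrite memv_img ?memvf.
Qed.

Lemma quot_map_proj (f : 'End(vT)) v :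
  (forall w, w \in W -> f w \in W) ->
  quot_map f (quot_proj v) = quot_proj (f v).
Proof.
move=> fW; apply/eqP; rewrite /quot_map -subr_eq0 -!raddfB -memv_ker.
by rewrite quot_proj_ker fW // -opprB rpredN proj_rest.
Qed.

End Quotient.

Section Series.
Variables (R : realType) (A : cardinality).

(* V / W, for invariant W <= V, inside the quotient of the whole space by W. *)
Definition irreducible_quotient (W V : {vspace device_space R A}) : Prop :=
  forall Y : {vspace quot_space W},
    (Y <= quot_proj W @: V)%VS ->
    (forall L, local_transformation L ->
       forall y, y \in Y -> quot_map L y \in Y) ->
    Y = 0%VS \/ Y = (quot_proj W @: V)%VS.

Definition strict_subspace (V W : {vspace device_space R A}) : bool :=
  (V <= W)%VS && (V != W).

Definition composition_series (s : seq {vspace device_space R A}) : Prop :=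
  [/\ ohead s = Some 0%VS,
      last 0%VS s = fullv,
      sorted strict_subspace s,
      forall V, V \in s -> invariant_subspace V
    & forall i, (i.+1 < size s)%N ->
        irreducible_quotient (nth 0%VS s i) (nth 0%VS s i.+1)].

End Series.

(* Main.v *)
(* For v in the device space, let osum x v be the sum of its entries for input
   x.  Then C is the space where every osum x v vanishes and C + Z the space
   where osum x v does not depend on x.  A deterministic map sends osum to
   osum o xi, so both spaces are invariant.  Conversely, let V be invariant and
   v in V.
   - If v <> 0, relabelling the outputs of one well-chosen input yields all
     differences of deterministic devices, which span C.
   - If some osum x v is not 0, forgetting the output of x yields all
     deterministic devices, hence C + Z.
   - If osum x0 v <> osum x1 v, using x0 for a single input k and x1 for all
     others yields every basis vector [a|k].
   So 0, C, C + Z and the whole space are the only invariant subspaces.  As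
   they are totally ordered, a composition series must list all of them. *)
From HB Require Import structures.
Require Import Defs.
From mathcomp Require Import all_boot all_order all_algebra.
From mathcomp Require Import reals.
Set Implicit Arguments.
Unset Strict Implicit.
Unset Printing Implicit Defensive.
Import GRing.Theory Num.Theory.
Local Open Scope ring_scope.

Section Device.
Variables (R : realType) (A : cardinality).
Implicit Types (x k : 'I_(ninputs A)) (v : device_space R A) (p q : label A).
Implicit Types (V : {vspace device_space R A}).

(** * Basis vectors, output sums and uniform blocks *)

Lemma labE q : q = lab (tagged q).
Proof. by case: q. Qed.

Lemma sum_label (T : nmodType) (F : label A -> T) :
  \sum_p F p = \sum_x \sum_(a < noutputs x) F (lab a).
Proof.
rewrite (sig_big_dep predT (fun x _ => true) (fun x a => F (lab a))) /=.
by apply: eq_bigr => -[].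
Qed.

Definition osum x v : R := \sum_(a < noutputs x) v (lab a).

Fact osum_linear x : linear_for *%R (osum x).
Proof.
move=> c u v; rewrite /osum mulr_sumr -big_split /=.
by apply: eq_bigr => a _; rewrite !ffunE.
Qed.

HB.instance Definition _ x :=
  GRing.isLinear.Build R (device_space R A) R *%R (osum x) (osum_linear x).

Lemma lab_eq x (a b : 'I_(noutputs x)) : (lab a == lab b) = (a == b).
Proof. by rewrite eq_Tagged. Qed.

Lemma lab_neq x y (a : 'I_(noutputs x)) (b : 'I_(noutputs y)) :
  x != y -> (lab a == lab b) = false.
Proof. by move=> ne_xy; apply/eqP => -[eq_xy]; rewrite eq_xy eqxx in ne_xy. Qed.

Lemma osum_ket x q : osum x (ket R q) = (x == tag q)%:R.
Proof.
case: q => y b; rewrite /osum /=; have [->|neq_xy] := eqVneq x y.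
  rewrite (bigD1 b) //= big1 ?addr0 => [|a ne_ab]; first by rewrite ffunE eqxx.
  by rewrite ffunE (lab_eq a b) (negPf ne_ab).
by apply: big1 => a _; rewrite ffunE lab_neq.
Qed.

Lemma ket_sum v : v = \sum_p v p *: ket R p.
Proof.
apply/ffunP => q; rewrite sum_ffunE (bigD1 q) //= big1 ?addr0 => [|p ne_pq].
  by rewrite !ffunE eqxx /= [RHS]mulr1.
by rewrite !ffunE eq_sym (negPf ne_pq) [LHS]mulr0.
Qed.

Lemma noutputs_neq0 x : (noutputs x)%:R != 0 :> R.
Proof. by rewrite pnatr_eq0 -lt0n noutputs_gt0. Qed.

Lemma ninputs_neq0 : (ninputs A)%:R != 0 :> R.
Proof. by rewrite pnatr_eq0 -lt0n ninputs_gt0. Qed.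

(** Common building block of [Zvec] and [Svec]: the uniform distribution on the outputs of [k],
    extended by zero to the other inputs. *)
Definition flat k : device_space R A :=
  \sum_(a < noutputs k) (noutputs k)%:R^-1 *: ket R (lab a).

Lemma Zvec_flat : Zvec R A = \sum_k flat k.
Proof. by []. Qed.

Lemma Svec_flat k : Svec R k = (ninputs A)%:R *: flat k - Zvec R A.
Proof.
by rewrite /Svec scaler_sumr; congr (_ - _); apply: eq_bigr => a _; rewrite scalerA.
Qed.

Lemma osum_flat x k : osum x (flat k) = (x == k)%:R.
Proof.
rewrite linear_sum /= (eq_bigr (fun=> (noutputs k)%:R^-1 * (x == k)%:R)).
  by rewrite sumr_const card_ord -[LHS]mulr_natl mulrA mulfV ?mul1r ?noutputs_neq0.
by move=> a _; rewrite linearZ /= osum_ket.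
Qed.

Lemma flatE k q : flat k q = (tag q == k)%:R / (noutputs (tag q))%:R.
Proof.
case: q => x b /=; rewrite /flat sum_ffunE; have [eq_xk|neq] := eqVneq x k.
  rewrite -{k}eq_xk.
  rewrite (bigD1 b) //= big1 ?addr0 => [|a ne_ab]; rewrite !ffunE /=.
    by rewrite eqxx [LHS]mulr1 mul1r.
  by rewrite (lab_eq b a) eq_sym (negPf ne_ab) [LHS]mulr0.
rewrite mul0r big1 // => a _; rewrite !ffunE.
by rewrite lab_neq // [LHS]mulr0.
Qed.

Lemma osum_Zvec x : osum x (Zvec R A) = 1.
Proof.
rewrite Zvec_flat linear_sum (bigD1 x) //= big1 ?addr0 => [|k ne_kx].
  by rewrite osum_flat eqxx.
by rewrite osum_flat eq_sym (negPf ne_kx).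
Qed.

(** * Membership in C, C + Z and S through output sums *)

Lemma ket_sub_last_Csp x (i : 'I_(noutputs x)) :
  ket R (lab i) - ket R (lab (last_output x)) \in Csp R A.
Proof.
have [lt_i|ge_i] := ltnP i (noutputs x).-1.
  rewrite -[X in X \in _](scalerKV (noutputs_neq0 x)) memvZ // memv_span //.
  apply/allpairsPdep; exists x, (Ordinal lt_i); rewrite !mem_enum; split=> //.
  by rewrite /Cvec; congr (_ *: (ket R (lab _) - _)); apply: val_inj.
(* No generator of [Csp] is attached to the last output, but there the difference is zero. *)
suff -> : i = last_output x by rewrite subrr mem0v.
apply: val_inj; apply/eqP; rewrite /= eqn_leq ge_i andbT.
by rewrite -ltnS prednK ?noutputs_gt0.
Qed.

Lemma Csp_osum v : reflect (forall x, osum x v = 0) (v \in Csp R A).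
Proof.
apply: (iffP idP) => [| v0].
  rewrite /Csp => Cv x; rewrite (coord_span (X := in_tuple _) Cv).
  rewrite linear_sum big1 // => i _; rewrite linearZ /=.
  suff /allP/(_ _ (mem_nth 0 (ltn_ord i)))/eqP-> :
      all (fun u => osum x u == 0)
        [seq Cvec R (widen_ord (leq_pred (noutputs y)) j)
           | y <- enum 'I_(ninputs A), j <- enum 'I_(noutputs y).-1].
    by rewrite mulr0.
  apply/allP => _ /allpairsPdep[y [j [_ _ ->]]].
  by rewrite linearZ /= linearB /= !osum_ket subrr mulr0.
(* The subtracted last-output kets of input [x] have total coefficient [osum x v], which is zero. *)
have -> : v = \sum_x \sum_(a < noutputs x)
    v (lab a) *: (ket R (lab a) - ket R (lab (last_output x))).
  rewrite [LHS]ket_sum sum_label; apply: eq_bigr => x _.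
  rewrite [RHS](eq_bigr _ (fun a _ => scalerBr _ _ _)).
  by rewrite sumrB -scaler_suml [X in X *: _]v0 scale0r subr0.
by apply: memv_suml => x _; apply: memv_suml => a _; rewrite memvZ ?ket_sub_last_Csp.
Qed.

(** Every output sum of Z is 1, so subtracting the common value times Z leaves a vector of C. *)
Lemma Csp_Zsp_osum v :
  reflect (forall x y, osum x v = osum y v) (v \in (Csp R A + Zsp R A)%VS).
Proof.
apply: (iffP idP) => [/memv_addP[u /Csp_osum Cu [_ /vlineP[t ->] ->]] x y | eq_v].
  by rewrite !linearD !linearZ /= !osum_Zvec !Cu.
pose x0 := Ordinal (ninputs_gt0 A).
rewrite -(subrK (osum x0 v *: Zvec R A) v) memv_add ?memvZ ?memv_line //.
by apply/Csp_osum => x; rewrite linearB linearZ /= osum_Zvec mulr1 (eq_v x x0) subrr.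
Qed.

Lemma sum_Svec : \sum_(k < ninputs A) Svec R k = 0.
Proof.
under eq_bigr do rewrite Svec_flat.
by rewrite sumrB -scaler_sumr sumr_const card_ord -scaler_nat subrr.
Qed.

Lemma Svec_Ssp k : Svec R k \in Ssp R A.
Proof.
have memS (j : 'I_(ninputs A)) : (j < (ninputs A).-1)%N -> Svec R j \in Ssp R A.
  move=> lt_j; apply: memv_span; apply/mapP; exists (Ordinal lt_j).
    by rewrite mem_enum.
  by congr (Svec R _); apply: val_inj.
have [/memS//|ge_k] := ltnP k (ninputs A).-1.
(* Here [k] is the last input, which has no generator of its own: its vector is minus the sum of all
   the others. *)
have /eqP := sum_Svec; rewrite (bigD1 k) //= addr_eq0 => /eqP->.
rewrite rpredN; apply: memv_suml => j ne_jk; apply: memS.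
rewrite ltnNge; apply: contraNN ne_jk => ge_j; apply/eqP/val_inj/eqP => /=.
have le_pred (i : 'I_(ninputs A)) : (i <= (ninputs A).-1)%N.
  by rewrite -ltnS prednK ?ninputs_gt0.
by rewrite eqn_leq (leq_trans (le_pred j) ge_k) (leq_trans (le_pred k) ge_j).
Qed.

(** Both properties are linear in [v], so they can be checked on the generators; together they
    separate S from C + Z. *)
Lemma Ssp_osum v : v \in Ssp R A ->
  \sum_x osum x v = 0 /\ forall q, v q = osum (tag q) v / (noutputs (tag q))%:R.
Proof.
rewrite /Ssp => Sv; rewrite (coord_span (X := in_tuple _) Sv).
split=> [|q].
  under eq_bigr do rewrite linear_sum; rewrite exchange_big big1 //= => i _.
  under eq_bigr do rewrite linearZ; rewrite /= -mulr_sumr.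
  have /mapP[k _ ->] := mem_nth 0 (ltn_ord i).
  under eq_bigr do rewrite Svec_flat linearB linearZ /= osum_Zvec osum_flat.
  rewrite sumrB sumr_const card_ord -mulr_sumr.
  set k' := widen_ord _ k.
  rewrite (bigD1 k') //= big1 ?eqxx ?addr0 ?mulr1 ?subrr ?mulr0 // => x ne_xk.
  by rewrite (negPf ne_xk).
rewrite sum_ffunE linear_sum mulr_suml; apply: eq_bigr => i _.
rewrite !ffunE linearZ /= -mulrA; congr (_ * _).
have /mapP[k _ ->] := mem_nth 0 (ltn_ord i).
rewrite Svec_flat linearB linearZ /= osum_Zvec osum_flat.
rewrite !ffunE flatE Zvec_flat sum_ffunE mulrBl mul1r -mulrA.
congr (_ - _); rewrite (bigD1 (tag q)) //= big1 ?addr0 => [|x ne_x].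
  by rewrite flatE eqxx mul1r.
by rewrite flatE eq_sym (negPf ne_x) mul0r.
Qed.

(** * Direct sum decomposition of the device space *)

Definition CZS_chain : seq {vspace device_space R A} :=
  [:: 0%VS; Csp R A; (Csp R A + Zsp R A)%VS; (Csp R A + Zsp R A + Ssp R A)%VS].

(** A multiple of Z with zero output sums is zero. A vector in both C + Z and S has equal output
    sums adding up to 0, so all are 0, and being uniform on each input it vanishes. *)
Lemma directv_CZS : directv (Csp R A + Zsp R A + Ssp R A).
Proof.
rewrite !directv_addE /= -!andbA; apply/and5P; split=> //; try exact: directv_trivial.
  apply/eqP/vspaceP => v; rewrite memv_cap memv0.
  apply/andP/eqP => [[/Csp_osum Cv /vlineP[t def_v]]|->]; last by rewrite !mem0v.
  have := Cv (Ordinal (ninputs_gt0 A)); rewrite def_v linearZ /= osum_Zvec mulr1 => ->.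
  by rewrite scale0r.
apply/eqP/vspaceP => v; rewrite memv_cap memv0.
apply/andP/eqP => [[/Csp_Zsp_osum eq_v /Ssp_osum[sum0 unif]]|->]; last by rewrite !mem0v.
apply/ffunP => q; rewrite unif ffunE.
have /eqP : (ninputs A)%:R * osum (tag q) v = 0.
  rewrite -sum0 (eq_bigr (fun=> osum (tag q) v)) => [|x _]; last exact: eq_v.
  by rewrite sumr_const card_ord mulr_natl.
by rewrite mulf_eq0 (negPf ninputs_neq0) /= => /eqP->; rewrite mul0r.
Qed.

(** Subtracting from [v] the combination of the [flat k] with the same output sums leaves a vector
    of C, and each [flat k] is a multiple of Z + S^k. *)
Lemma CZS_full : (Csp R A + Zsp R A + Ssp R A)%VS = fullv.
Proof.
apply/vspaceP => v; rewrite memvf.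
have flat_in k : flat k \in (Csp R A + Zsp R A + Ssp R A)%VS.
  have -> : flat k = (ninputs A)%:R^-1 *: (Zvec R A + Svec R k).
    by rewrite Svec_flat addrC subrK scalerK ?ninputs_neq0.
  rewrite memvZ // memv_add ?Svec_Ssp //.
  by rewrite (subvP (addvSr _ _)) ?memv_line.
rewrite -(subrK (\sum_k osum k v *: flat k) v) rpredD //; last first.
  by apply: memv_suml => k _; rewrite memvZ.
rewrite (subvP (addvSl _ _)) // (subvP (addvSl _ _)) //; apply/Csp_osum => x.
rewrite linearB linear_sum /= (bigD1 x) //= big1 => [|k ne_kx].
  by rewrite linearZ /= osum_flat eqxx mulr1 addr0 subrr.
by rewrite linearZ /= osum_flat eq_sym (negPf ne_kx) mulr0.
Qed.

(** * Deterministic maps and invariance of the terms of the chain *)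

Lemma det_actE xi (alpha : forall x', 'I_(noutputs (xi x')) -> 'I_(noutputs x')) v q :
  linfun (mx_act (det_entry R alpha)) v q =
    \sum_(b | alpha (tag q) b == tagged q) v (lab b).
Proof.
rewrite lfunE ffunE sum_label (bigD1 (xi (tag q))) //= [X in _ + X]big1 => [|x ne_x].
  rewrite addr0 [RHS]big_mkcond; apply: eq_bigr => b _; rewrite /det_entry.
  have -> : [exists b', (lab b == lab b') && (tagged q == alpha (tag q) b')]
      = (alpha (tag q) b == tagged q).
    apply/existsP/idP => [[b' /andP[]]|eq_b].
      by rewrite lab_eq eq_sym => /eqP-> /eqP->.
    by exists b; rewrite eqxx eq_sym.
  by case: ifP => _; rewrite ?mul1r ?mul0r.
apply: big1 => a _; rewrite /det_entry; case: existsP => [[b /andP[/eqP[] /eqP]]|_].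
  by rewrite (negPf ne_x).
by rewrite mul0r.
Qed.

(** Each output [b] of [xi x] is sent to exactly one output of [x], so it is counted once. *)
Lemma osum_det xi (alpha : forall x', 'I_(noutputs (xi x')) -> 'I_(noutputs x')) v x :
  osum x (linfun (mx_act (det_entry R alpha)) v) = osum (xi x) v.
Proof.
rewrite /osum; under eq_bigr do rewrite det_actE /=.
rewrite (exchange_big_dep predT) //=; apply: eq_bigr => b _.
by apply: big_pred1 => a; rewrite eq_sym.
Qed.

Lemma det_local xi (alpha : forall x', 'I_(noutputs (xi x')) -> 'I_(noutputs x')) :
  local_transformation (linfun (mx_act (det_entry R alpha))).
Proof.
exists 1%N, (fun=> 1), (fun=> linfun (mx_act (det_entry R alpha))); split=> //.
- by rewrite big_ord1.
- by move=> _; exists xi, alpha.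
- by rewrite big_ord1 scale1r.
Qed.

Lemma invariant_det V :
  (forall xi (alpha : forall x', 'I_(noutputs (xi x')) -> 'I_(noutputs x')) v,
     v \in V -> linfun (mx_act (det_entry R alpha)) v \in V) ->
  invariant_subspace V.
Proof.
move=> detV L [n [w [D [_ _ detD ->]]]] v Vv; rewrite sum_lfunE.
apply: memv_suml => i _; rewrite scale_lfunE memvZ //.
by have [xi [alpha ->]] := detD i; apply: detV.
Qed.

Lemma invariant0 : invariant_subspace (0%VS : {vspace device_space R A}).
Proof. by move=> L _ v; rewrite !memv0 => /eqP->; rewrite linear0. Qed.

Lemma invariant_full : invariant_subspace (fullv : {vspace device_space R A}).
Proof. by move=> L _ v _; rewrite memvf. Qed.

Lemma invariant_Csp : invariant_subspace (Csp R A).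
Proof.
apply: invariant_det => xi alpha v /Csp_osum Cv.
by apply/Csp_osum => x; rewrite osum_det.
Qed.

Lemma invariant_Csp_Zsp : invariant_subspace (Csp R A + Zsp R A).
Proof.
apply: invariant_det => xi alpha v /Csp_Zsp_osum Cv.
by apply/Csp_Zsp_osum => x y; rewrite !osum_det.
Qed.

(** * Deterministic devices and classification of invariant subspaces *)

Definition pure (c : forall x, 'I_(noutputs x)) : device_space R A :=
  [ffun q => (tagged q == c (tag q))%:R].

Lemma osum_pure c x : osum x (pure c) = 1.
Proof.
rewrite /osum (bigD1 (c x)) //= big1 => [|a ne_a]; rewrite ffunE /=.
  by rewrite eqxx addr0.
by rewrite (negPf ne_a).
Qed.

(** Changing a single output of a deterministic device produces, up to scaling, the generators of
    C. *)
Lemma pure_dfwith x (i : 'I_(noutputs x)) (c : forall x, 'I_(noutputs x)) :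
  pure (dfwith c i) - pure c = ket R (lab i) - ket R (lab (c x)).
Proof.
apply/ffunP => -[y a]; rewrite !ffunE /=; have [eq_yx|ne_yx] := eqVneq x y.
  by case: y / eq_yx a => a; rewrite dfwith_in !lab_eq.
by rewrite dfwith_out // subrr !lab_neq ?subrr // eq_sym.
Qed.

Section Invariant.
Variable V : {vspace device_space R A}.
Hypothesis invV : invariant_subspace V.

(* Apply the deterministic map with xi constant to x0 whose outputs are those
   of c when x0 yields b, and those of d otherwise. *)
Lemma invariant_split x0 (b : 'I_(noutputs x0)) c d v : v \in V ->
  v (lab b) *: (pure c - pure d) + osum x0 v *: pure d \in V.
Proof.
pose alpha x' (b' : 'I_(noutputs x0)) := if b' == b then c x' else d x'.
move=> /(invV (@det_local (fun=> x0) alpha)); congr (_ \in V).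
apply/ffunP => q; rewrite det_actE !ffunE /alpha.
have -> : osum x0 v = v (lab b) + \sum_(b' | b' != b) v (lab b').
  by rewrite /osum (bigD1 b).
rewrite big_mkcond (bigD1 b) //= eqxx.
under eq_bigr => b' ne_b do rewrite (negPf ne_b).
rewrite !(eq_sym (tagged q)) /GRing.scale /=.
by case: (c _ == _); case: (d _ == _); rewrite ?big1_eq
  ?(mulr1n, mulr0n, subrr, subr0, sub0r, mulrN1, mulr0, mulr1, addr0, add0r, addKr).
Qed.

(** Taking [d] equal to [c] in [invariant_split] kills the difference, so any output [b] of [x0]
    serves. *)
Lemma pure_invariant x0 c v : v \in V -> osum x0 v != 0 -> pure c \in V.
Proof.
move=> Vv s_neq0; have := invariant_split (last_output x0) c c Vv.
by rewrite subrr scaler0 add0r => /(memvZ (osum x0 v)^-1); rewrite scalerK.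
Qed.

(** If some output sum of a nonzero [v] is nonzero, both devices lie in [V]. Otherwise the second
    term of [invariant_split] vanishes, and a nonzero entry of [v] isolates the difference. *)
Lemma pureB_invariant c d : V != 0%VS -> pure c - pure d \in V.
Proof.
move=> V_neq0; have Vv := memv_pick V; set v := vpick V in Vv.
have v_neq0 : v != 0 by rewrite vpick0.
have [/existsP[x0 s_neq0]|/existsPn s_eq0] := boolP [exists x0, osum x0 v != 0].
  by rewrite rpredB ?(pure_invariant _ Vv s_neq0).
have /existsP[q vq_neq0] : [exists q, v q != 0].
  apply: contraNT v_neq0 => /existsPn v0; apply/eqP/ffunP => q.
  by have := v0 q; rewrite negbK => /eqP->; rewrite ffunE.
have := invariant_split (tagged q) c d Vv; rewrite -labE.
have /negPn/eqP-> := s_eq0 (tag q); rewrite scale0r addr0.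
by move=> /(memvZ (v q)^-1); rewrite scalerK.
Qed.

Lemma invariant_geC : V != 0%VS -> (Csp R A <= V)%VS.
Proof.
move=> V_neq0; apply/span_subvP => _ /allpairsPdep[x [i [_ _ ->]]].
by rewrite memvZ // -pure_dfwith pureB_invariant.
Qed.

Lemma invariant_geCZ : ~~ (V <= Csp R A)%VS -> (Csp R A + Zsp R A <= V)%VS.
Proof.
move=> /subvPn[v Vv /Csp_osum Cv].
have [x0 s_neq0] : exists x0, osum x0 v != 0.
  by apply/existsP/existsPn => s0; apply: Cv => x; apply/eqP/negPn.
have CV : (Csp R A <= V)%VS.
  apply: invariant_geC; apply: contraNneq s_neq0 => V0.
  by move: Vv; rewrite V0 memv0 => /eqP->; rewrite linear0.
(* Z and any deterministic device have all output sums equal to 1, so they differ by a vector of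
   C. *)
rewrite subv_add CV -memvE -(subrK (pure (@last_output A)) (Zvec R A)).
rewrite rpredD ?(pure_invariant _ Vv s_neq0) // (subvP CV) //.
by apply/Csp_osum => x; rewrite linearB /= osum_Zvec osum_pure subrr.
Qed.

Lemma invariant_eq_full : ~~ (V <= Csp R A + Zsp R A)%VS -> V = fullv.
Proof.
move=> VnCZ; have /subvPn[v Vv /Csp_Zsp_osum sv] := VnCZ.
have pureV c : pure c \in V.
  apply: (subvP (invariant_geCZ _)).
    by apply: contraNN VnCZ => /subv_trans-> //; apply: addvSl.
  by apply/Csp_Zsp_osum => x y; rewrite !osum_pure.
have [x0 [x1 s_neq]] : exists x0 x1, osum x0 v != osum x1 v.
  have [/existsP[x0 /existsP[x1]]|/existsPn s0] :=
    boolP [exists x0, [exists x1, osum x0 v != osum x1 v]]; first by exists x0, x1.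
  case: sv => x y; have /existsPn := s0 x.
  by move/(_ y)/negPn/eqP.
apply/vspaceP => u; rewrite memvf [u]ket_sum; apply: memv_suml => -[k a] _.
rewrite memvZ //.
pose c := dfwith (@last_output A) a.
(* The image of [v] is [pure c] scaled by [osum x0 v] at input [k] and by [osum x1 v] elsewhere;
   removing [osum x1 v *: pure c] leaves a nonzero multiple of the ket of [a]. *)
pose alpha x' (_ : 'I_(noutputs (if x' == k then x0 else x1))) := c x'.
have := rpredB (invV (det_local alpha) Vv) (memvZ (osum x1 v) (pureV c)).
suff -> : linfun (mx_act (det_entry R alpha)) v - osum x1 v *: pure c
            = (osum x0 v - osum x1 v) *: ket R (lab a).
  move=> /(memvZ (osum x0 v - osum x1 v)^-1).
  by rewrite scalerK ?subr_eq0.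
apply/ffunP => -[x b]; rewrite !ffunE det_actE /alpha /= (eq_sym b).
have -> : \sum_(b' < noutputs (if x == k then x0 else x1) | c x == b) v (lab b')
    = osum (if x == k then x0 else x1) v * (c x == b)%:R.
  by case: (c x == b); rewrite ?mulr1 // mulr0 big_pred0_eq.
rewrite /c; case: dfwithP => [|j ne_kj] in b *.
  by rewrite eqxx lab_eq (eq_sym b) scalerBl.
by rewrite lab_neq eq_sym // (negPf ne_kj) subrr scaler0.
Qed.

Lemma invariant_mem : V \in CZS_chain.
Proof.
rewrite /CZS_chain CZS_full !inE; have [//|/invariant_geC CV /=] := eqVneq V 0%VS.
have [VC|/invariant_geCZ CZV] := boolP (V <= Csp R A)%VS.
  by rewrite eqEsubv VC CV.
have [VCZ|/invariant_eq_full->] := boolP (V <= Csp R A + Zsp R A)%VS.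
  by rewrite (eqEsubv V (_ + _)) VCZ CZV orbT.
by rewrite eqxx !orbT.
Qed.

End Invariant.

Lemma invariant_subspaceP V :
  reflect (invariant_subspace V) (V \in CZS_chain).
Proof.
apply: (iffP idP) => [|/invariant_mem//]; rewrite /CZS_chain CZS_full !inE.
case/or4P=> /eqP->; [exact: invariant0 | exact: invariant_Csp
  | exact: invariant_Csp_Zsp | exact: invariant_full].
Qed.

Lemma invariant_total V W :
  invariant_subspace V -> invariant_subspace W -> (V <= W)%VS || (W <= V)%VS.
Proof.
move=> /invariant_mem + /invariant_mem; rewrite !inE.
case/or4P=> /eqP-> /or4P[] /eqP->;
  by rewrite ?CZS_full ?subvv ?sub0v ?subvf ?addvSl ?orbT.
Qed.

(** * Strict chains, irreducible quotients and composition series *)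

Lemma strict_subspace_trans : transitive (@strict_subspace R A).
Proof.
move=> V U W /andP[UV neUV] /andP[VW neVW].
rewrite /strict_subspace (subv_trans UV VW); apply: contraNN neUV => /eqP eqUW.
by rewrite eqEsubv UV eqUW.
Qed.

Lemma strict_subspace_irr : irreflexive (@strict_subspace R A).
Proof. by move=> V; rewrite /strict_subspace eqxx andbF. Qed.

Lemma invariant_preim W (Y : {vspace quot_space W}) :
  invariant_subspace W ->
  (forall L : 'End(device_space R A),
     local_transformation L -> forall y, y \in Y -> quot_map L y \in Y) ->
  invariant_subspace (quot_proj W @^-1: Y).
Proof.
move=> invW invY L locL v; rewrite -!memv_preim => Yv.
by rewrite -quot_map_proj ?invY // => w; apply: invW.
Qed.

(** Correspondence theorem: image and preimage under [quot_proj W] match the invariant subspaces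
    between [W] and [V] with those of the quotient. *)
Lemma irreducible_quotientP W V :
  invariant_subspace W -> (W <= V)%VS ->
  irreducible_quotient W V <->
  (forall U, invariant_subspace U -> (W <= U <= V)%VS -> U = W \/ U = V).
Proof.
move=> invW WV; split=> [irrV U invU /andP[WU UV] | onlyWV Y YV invY].
  have eqU X : (W <= X)%VS -> (quot_proj W @^-1: (quot_proj W @: X))%VS = X.
    move=> WX; apply/vspaceP => v; rewrite -memv_preim.
    apply/idP/idP => [/memv_imgP[u Xu /eqP]|]; last exact: memv_img.
    rewrite -subr_eq0 -linearB -memv_ker quot_proj_ker => /(subvP WX) Xvu.
    by rewrite -(subrK u v) rpredD.
  have [|L locL _ /memv_imgP[u Uu ->]|/eqP|eqUV] := irrV (quot_proj W @: U)%VS.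
  - exact: limgS.
  - by rewrite quot_map_proj ?memv_img ?invU // => w; apply: invW.
  - rewrite -lkerE quot_proj_ker => UW.
    by left; apply/eqP; rewrite eqEsubv UW.
  - by right; rewrite -(eqU U) // eqUV eqU.
have YK : (quot_proj W @: (quot_proj W @^-1: Y))%VS = Y.
  by apply: lpreimK; rewrite quot_proj_onto subvf.
have [|eqU|eqU] := onlyWV _ (invariant_preim invW invY).
- apply/andP; split; first by rewrite -{1}(quot_proj_ker W) -lpreim0 lpreimS ?sub0v.
  apply/subvP => v; rewrite -memv_preim => /(subvP YV)/memv_imgP[u Vu /eqP].
  rewrite -subr_eq0 -linearB -memv_ker quot_proj_ker => /(subvP WV) Vvu.
  by rewrite -(subrK u v) rpredD.
- by left; rewrite -YK eqU; apply/eqP; rewrite -lkerE quot_proj_ker.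
- by right; rewrite -YK eqU.
Qed.

Lemma composition_seriesP s :
  composition_series s <->
  sorted (@strict_subspace R A) s /\ (forall V, V \in s <-> invariant_subspace V).
Proof.
have sub_nth t i j : sorted (@strict_subspace R A) t -> (i <= j < size t)%N ->
    (nth 0%VS t i <= nth 0%VS t j)%VS.
  move=> sort_t /andP[le_ij lt_j]; apply: (sorted_leq_nth (leT := subsetv)) => //.
  - exact: subv_trans.
  - by apply: sub_sorted sort_t => U W /andP[].
  - by rewrite inE (leq_ltn_trans le_ij).
split=> [[head0 lastT sort_s inv_s irr_s] | [sort_s mem_s]].
  split=> // U; split=> [/inv_s//|invU].
  have s_gt0 : (0 < size s)%N by case: (s) head0.
  have nth0 : nth 0%VS s 0 = 0%VS by case: (s) head0 => //= ? ? [].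
  have [i] : exists i, (i < size s)%N && (nth 0%VS s i <= U)%VS.
    by exists 0%N; rewrite s_gt0 nth0 sub0v.
  have bound j : (j < size s)%N && (nth 0%VS s j <= U)%VS -> (j <= size s)%N.
    by case/andP => /ltnW.
  (* Take the last term of [s] below [U]. By total ordering the next term, if any, contains [U], and
     irreducibility makes [U] one of the two. *)
  move=> exi; case: (ex_maxnP (ex_intro _ i exi) bound) => {exi}i /andP[lt_i siU] max_i.
  have s_i := mem_nth 0%VS lt_i.
  have [lt_i1|ge_i1] := ltnP i.+1 (size s); last first.
    suff -> : U = nth 0%VS s i by [].
    have nth_i : nth 0%VS s i = fullv.
      rewrite -lastT -nth_last; congr nth; apply/eqP.
      by rewrite -eqSS prednK // eqn_leq lt_i ge_i1.
    by apply/eqP; rewrite eqEsubv siU nth_i subvf.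
  have s_i1 := mem_nth 0%VS lt_i1.
  have Us : (U <= nth 0%VS s i.+1)%VS.
    have /orP[//|le_U] := invariant_total invU (inv_s _ s_i1).
    by have := max_i i.+1; rewrite lt_i1 le_U ltnn => /(_ isT).
  have le_si : (nth 0%VS s i <= nth 0%VS s i.+1)%VS by rewrite sub_nth ?leqnSn.
  have [|->|->] // := (irreducible_quotientP (inv_s _ s_i) le_si).1 (irr_s _ lt_i1) _ invU.
  by rewrite siU.
(* Zero and the whole space occur somewhere in [s]; monotonicity then forces the first and last
   terms. *)
have /(nthP 0%VS)[m lt_m nth_m] := (mem_s _).2 invariant0.
have /(nthP 0%VS)[n lt_n nth_n] := (mem_s _).2 invariant_full.
have s_gt0 : (0 < size s)%N by apply: leq_ltn_trans lt_m.
split=> // [|| V /mem_s // | i lt_i1].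
- have : (nth 0%VS s 0 <= 0)%VS by rewrite -{2}nth_m sub_nth.
  by case: (s) s_gt0 => //= W t _; rewrite subv0 => /eqP->.
- apply/eqP; rewrite -nth_last eqEsubv subvf -nth_n sub_nth //.
  by rewrite -ltnS prednK // lt_n leqnn.
have lt_i := ltnW lt_i1.
have inv_nth j : (j < size s)%N -> invariant_subspace (nth 0%VS s j).
  by move=> lt_j; apply/mem_s/mem_nth.
apply/irreducible_quotientP => [||U /mem_s/(nthP 0%VS)[j lt_j <-] /andP[ge_j le_j]].
- exact: inv_nth.
- by rewrite sub_nth ?leqnSn.
have [le_ji|lt_ij] := leqP j i.
  by left; apply/eqP; rewrite eqEsubv ge_j sub_nth ?le_ji.
by right; apply/eqP; rewrite eqEsubv le_j sub_nth ?lt_ij.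
Qed.

(** A list sorted for a transitive irreflexive relation is determined by its members, here all
    invariant subspaces. *)
Lemma invariant_chain_series s :
  composition_series s <-> s = undup CZS_chain.
Proof.
have sort_undup : sorted (@strict_subspace R A) (undup CZS_chain).
  (* Strictness splits into inclusion, inherited from the full chain, and distinctness, supplied by
     [undup]. *)
  rewrite (sorted_pairwise strict_subspace_trans).
  rewrite [pairwise _ _](pairwise_relI subsetv (fun U V => U != V)).
  rewrite -uniq_pairwise undup_uniq andbT.
  rewrite -sorted_pairwise; last exact: subv_trans.
  by apply: undup_sorted; [exact: subv_trans | rewrite /= sub0v !addvSl].
split=> [/composition_seriesP[sort_s mem_s] | ->].
  apply: (irr_sorted_eq strict_subspace_trans strict_subspace_irr sort_s sort_undup).
  by move=> V; rewrite mem_undup; apply/idP/invariant_subspaceP => /mem_s.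
apply/composition_seriesP; split=> // V; rewrite mem_undup.
by split=> /invariant_subspaceP.
Qed.

End Device.

Theorem proposition7 (R : realType) (A : cardinality) :
  [/\ directv (Csp R A + Zsp R A + Ssp R A)%VS,
      (0 <= Csp R A)%VS,
      (Csp R A <= Csp R A + Zsp R A)%VS,
      (Csp R A + Zsp R A <= Csp R A + Zsp R A + Ssp R A)%VS
    & (Csp R A + Zsp R A + Ssp R A)%VS = fullv]
  /\ [/\ invariant_subspace (0%VS : {vspace device_space R A}),
         invariant_subspace (Csp R A),
         invariant_subspace (Csp R A + Zsp R A)%VS
       & invariant_subspace (Csp R A + Zsp R A + Ssp R A)%VS]
  /\ (forall s : seq {vspace device_space R A},
        composition_series s <->
        s = undup [:: 0%VS; Csp R A; (Csp R A + Zsp R A)%VS;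
                      (Csp R A + Zsp R A + Ssp R A)%VS]).
Proof.
split; first split.
- exact: directv_CZS.
- exact: sub0v.
- exact: addvSl.
- exact: addvSl.
- exact: CZS_full.
split; last exact: invariant_chain_series.
split; rewrite ?CZS_full.
- exact: invariant0.
- exact: invariant_Csp.
- exact: invariant_Csp_Zsp.
- exact: invariant_full.
Qed.
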